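(* Let $(X,d,\mathfrak m)$ be a metric measure space such that $(X,d)$ is complete. Then $$\mathrm{BV}_{\rm H}(X)=\mathrm{BV}_{\rm H}(X;\mathrm{LIP}_b(X)),$$ and $\|\mathbf Df\|_{*,\mathrm{LIP}_b(X)}=\|\mathbf Df\|_*$ for every $f\in\mathrm{BV}_{\rm H}(X)$.
   Context: A metric measure space is a triple $(X,d,\mathfrak m)$ where $(X,d)$ is a metric space (not assumed separable) and $\mathfrak m\ge 0$ is a finite Radon measure on $X$ (a finite Borel measure that is inner regular with respect to compact sets). For $f:X\to\mathbb R$ and $E\subseteq X$ let $\mathrm{Lip}(f;E)=\sup\{|f(x)-f(y)|/d(x,y): x,y\in E,\ x\ne y\}\in[0,\infty]$ ($\sup\varnothing=0$). $\mathrm{LIP}_{loc}(X)$ is the set of continuous $f:X\to\mathbb R$ with $\inf_{r>0}\mathrm{Lip}(f;B_r(x))<\infty$ for all $x\in X$, where $B_r(x)$ is the open ball; the asymptotic slope of such $f$ is $\mathrm{lip}_a(f)(x)=\inf_{r>0}\mathrm{Lip}(f;B_r(x))$. $\mathrm{LIP}_\star(X)$ is the algebra of bounded functions $f\in\mathrm{LIP}_{loc}(X)$ with $\mathrm{lip}_a(f)\in L^1(\mathfrak m)$. $\mathrm{LIP}_b(X)\subseteq\mathrm{LIP}_\star(X)$ is the algebra of bounded (globally) Lipschitz functions. For $\mathscr A\in\{\mathrm{LIP}_b(X),\mathrm{LIP}_\star(X)\}$, $\mathrm{BV}_{\rm H}(X;\mathscr A)$ is the set of $f\in L^1(\mathfrak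 m)$ for which there is $(f_n)_n\subseteq\mathscr A$ with $f_n\to f$ in $L^1(\mathfrak m)$ and $\sup_n\int \mathrm{lip}_a(f_n)\,d\mathfrak m<\infty$. For such $f$, $\|\mathbf Df\|_{*,\mathscr A}=\inf\{\liminf_n\int\mathrm{lip}_a(f_n)\,d\mathfrak m : (f_n)_n\subseteq\mathscr A,\ f_n\to f\text{ in }L^1(\mathfrak m)\}$. When $\mathscr A=\mathrm{LIP}_\star(X)$ one writes $\mathrm{BV}_{\rm H}(X)$ and $\|\mathbf Df\|_*$. *)

(* Defs.v *)
From HB Require Import structures.
From mathcomp Require Import all_boot all_order all_algebra.
From mathcomp Require Import all_classical all_reals all_analysis.

Set Implicit Arguments.
Unset Strict Implicit.
Unset Printing Implicit Defensive.

Import Order.TTheory GRing.Theory Num.Theory.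
Import numFieldNormedType.Exports.

Local Open Scope classical_set_scope.
Local Open Scope ring_scope.

HB.mixin Record Metric_isBorel (R : realType) (d : measure_display) T
    & Metric R T & Measurable d T := {
  borel_measurableE : (measurable : set (set T)) = <<s open >>
}.

(* Measurable inherits from Pointed, so the spaces below are nonempty. *)
#[short(type="borelMetricType")]
HB.structure Definition BorelMetric (R : realType) (d : measure_display) :=
  {T of Metric R T & Measurable d T & Metric_isBorel R d T}.

Section metric_measure_space.
Context {R : realType} {d : measure_display} {X : borelMetricType R d}.
Implicit Types (f : X -> R) (E : set X) (x : X).
Local Open Scope ereal_scope.

Definition radon (m : set X -> \bar R) :=
  forall E, measurable E ->
    m E = ereal_sup [set m K | K in [set K | compact K /\ K `<=` E]].

(* The quotients are nonnegative: adding 0 only enforces sup set0 = 0. *)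
Definition Lip f E : \bar R :=
  ereal_sup ([set 0%:E] `|`
             [set (`|f p.1 - f p.2| / mdist p.1 p.2)%:E%R
              | p in [set p | [/\ E p.1, E p.2 & p.1 != p.2]]]).

Definition lip_a f x : \bar R :=
  ereal_inf [set Lip f (ball x r) | r in [set r : R | (0 < r)%R]].

Definition LIP_loc : set (X -> R) :=
  [set f | continuous f /\ forall x, lip_a f x < +oo].

Definition LIP_b : set (X -> R) :=
  [set f | bounded_fun f /\ Lip f setT < +oo].

Variable m : {finite_measure set X -> \bar R}.

Definition LIP_star : set (X -> R) :=
  [set f | [/\ bounded_fun f, LIP_loc f & m.-integrable setT (lip_a f)]].

(* Elements of L^1(m) are handled through their representatives; membership in
   BV_H and the value of Dstar only depend on the m-a.e. class of f. *)
Definition L1_approx (A : set (X -> R)) f : set (nat -> X -> R) :=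
  [set g | (forall n, A (g n)) /\
           \int[m]_x `|(g n x - f x)%:E| @[n --> \oo] --> 0].

Definition BV_H (A : set (X -> R)) : set (X -> R) :=
  [set f | m.-integrable setT (EFin \o f) /\
           exists2 g, L1_approx A f g &
             ereal_sup (range (fun n => \int[m]_x lip_a (g n) x)) < +oo].

Definition Dstar (A : set (X -> R)) f : \bar R :=
  ereal_inf [set limn_einf (fun n => \int[m]_x lip_a (g n) x)
              | g in L1_approx A f].

End metric_measure_space.

Definition metric_complete {R : realType} (X : metricType R) :=
  forall u : nat -> X, cauchy (u @ \oo) -> exists l : X, u @ \oo --> l.

(* Main.v *)
Require Import Defs.
From mathcomp Require Import all_boot all_order all_algebra.
From mathcomp Require Import all_classical all_reals all_analysis.
From mathcomp Require Import measurable_realfun lra.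

(* Any f in LIP_star is approximated in energy by bounded Lipschitz functions.
   Let h = lip_a f, which is upper semicontinuous and finite, and fix delta > 0.
   Inner regularity gives increasing compact sets C_k, contained in the open sets
   {h < k delta} and exhausting them up to measure 2^-(k+1).  The step function
   rho_n = delta #{k < n : dist(x, C_k) >= 1/(n+1)} is bounded, upper
   semicontinuous and has integral at most \int h + delta (m X + 1).  Let f_n x be
   the infimum, over the chains of mesh < 1/(n+1) ending at x, of the value of f
   at the origin plus the cost of the chain measured with the weight rho_n.  Then
   f_n <= f is bounded and Lipschitz and lip_a f_n <= rho_n.

   On each C_k, f_n = f for n large.  Otherwise infinitely many n admit a chain
   ending at x whose cost is too small, hence having a step from some y_n along
   which f grows by more than the cost of the step.  Being far from C_j costs at
   least delta j per unit length while the total cost is at most 2 sup |f|, so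
   the y_n come arbitrarily close to the compact sets C_j and, by completeness,
   cluster at some y.  If k is minimal with h y < k delta, then y is not in
   C_(k-1), so rho_n >= k delta near y, whereas f is k delta-Lipschitz near y: a
   contradiction.  Dominated convergence gives f_n -> f in L^1, and a diagonal
   argument concludes. *)

Set Implicit Arguments.
Unset Strict Implicit.
Unset Printing Implicit Defensive.

Import Order.TTheory GRing.Theory Num.Theory.
Import numFieldNormedType.Exports.

Local Open Scope classical_set_scope.
Local Open Scope ring_scope.

(** * Asymptotic slopes and bounded Lipschitz functions *)

Section asymptotic_slope.
Context {R : realType} {d : measure_display} {X : borelMetricType R d}.
Implicit Types (f : X -> R) (E : set X) (x y : X) (r c : R).

Lemma Lip_ge0 f E : (0 <= Lip f E)%E.
Proof. by apply: ereal_sup_ubound; left. Qed.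

Lemma Lip_leP f E c : 0 <= c ->
  (Lip f E <= c%:E)%E <->
  forall x y, E x -> E y -> `|f x - f y| <= c * mdist x y.
Proof.
move=> c0; split=> [Lc x y Ex Ey|fc].
  have [->|xy] := eqVneq x y; first by rewrite subrr normr0 mulr_ge0 ?mdist_ge0.
  rewrite -ler_pdivrMr ?mdist_gt0// -lee_fin (le_trans _ Lc)//.
  by apply: ereal_sup_ubound; right; exists (x, y).
apply: ge_ereal_sup => _ [->|[[x y] /= [Ex Ey xy] <-]]; first by rewrite lee_fin.
by rewrite lee_fin ler_pdivrMr ?mdist_gt0//; exact: fc.
Qed.

Lemma le_Lip f E F : E `<=` F -> (Lip f E <= Lip f F)%E.
Proof.
move=> EF; apply: ereal_sup_le => z [->|[p [Ep1 Ep2 p12] <-]]; first by left.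
by right; exists p => //; split => //; exact: EF.
Qed.

Lemma lip_a_ge0 f x : (0 <= lip_a f x)%E.
Proof. by apply: le_ereal_inf_tmp => _ [r _ <-]; exact: Lip_ge0. Qed.

Lemma lip_a_le_Lip_ball f x r : 0 < r -> (lip_a f x <= Lip f (ball x r))%E.
Proof. by move=> r0; apply: ereal_inf_lbound; exists r. Qed.

Lemma lip_a_lt f x (c : \bar R) : (lip_a f x < c)%E ->
  exists2 r, 0 < r & (Lip f (ball x r) < c)%E.
Proof. by move/ereal_inf_lt => [_ [r r0 <-] rc]; exists r. Qed.

(** A bound on the ball of radius [r] at [x] passes to the balls of radius [r / 2] at all points
    within [r / 2] of [x]. This upper semicontinuity makes [lip_a f] Borel. *)
Lemma open_lip_a_lt f (c : \bar R) : open [set x | lip_a f x < c]%E.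
Proof.
rewrite openE => x /= /lip_a_lt[r r0 rc]; apply/nbhs_ballP.
exists (r / 2) => [|y xy /=]; first by rewrite /= divr_gt0.
apply: le_lt_trans rc.
have r20 : 0 < r / 2 by rewrite divr_gt0.
apply: le_trans (lip_a_le_Lip_ball f y r20) _.
by apply: le_Lip => z yz; rewrite [r]splitr; exact: ball_triangle yz.
Qed.

Lemma borel_open_measurable (A : set X) : open A -> measurable A.
Proof. by move=> oA; rewrite borel_measurableE; exact: sub_sigma_algebra. Qed.

Lemma borel_closed_measurable (A : set X) : closed A -> measurable A.
Proof.
move=> cA; rewrite -(setCK A); apply: measurableC.
by apply: borel_open_measurable; exact: closed_openC.
Qed.

Lemma compact_closed_measurable (A : set X) :
  compact A -> closed A /\ measurable A.
Proof.
move=> cA; have clA := compact_closed (@metric_hausdorff R X) cA.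
by split=> //; exact: borel_closed_measurable.
Qed.

Lemma continuous_borel_measurable f : continuous f -> measurable_fun setT f.
Proof.
move=> /continuousP cf; apply: (measurability _ (RGenOpens.measurableE R)).
move=> _ [_ [a [b ->] <-]]; rewrite setTI; apply: borel_open_measurable.
exact/cf/interval_open.
Qed.

Lemma measurable_lip_a f : measurable_fun setT (lip_a f).
Proof.
apply: (measurability _ (ErealGenCInfty.measurableE R)).
move=> _ [_ [a ->]] <-; rewrite setTI.
rewrite (_ : _ @^-1` _ = ~` [set x | lip_a f x < a%:E]%E).
  by apply: measurableC; apply: borel_open_measurable; exact: open_lip_a_lt.
apply/seteqP; split => x /=; rewrite in_itv /= andbT leNgt => /negP//.
Qed.

Lemma LIP_bP f : LIP_b f -> exists2 c, 0 <= c &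
  forall x y, `|f x - f y| <= c * mdist x y.
Proof.
move=> [_ Lf]; have Lfin : Lip f setT \is a fin_num.
  by rewrite ge0_fin_numE ?Lip_ge0.
have c0 : 0 <= fine (Lip f setT) by rewrite fine_ge0 ?Lip_ge0.
exists (fine (Lip f setT)) => // x y.
by apply: (Lip_leP f setT c0).1 => //; rewrite fineK.
Qed.

Lemma LIP_b_continuous f : LIP_b f -> continuous f.
Proof.
move=> /LIP_bP[c c0 fc] x; apply/cvgrPdist_lt => e e0.
apply/nbhs_ballP; exists (e / (c + 1)) => /= [|y].
  by rewrite divr_gt0// ltr_wpDl.
rewrite ballEmdist /= ltr_pdivlMr ?ltr_wpDl// => xy.
apply: le_lt_trans (fc x y) (le_lt_trans _ xy).
by rewrite mulrC ler_wpM2l ?mdist_ge0// lerDl.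
Qed.

Lemma bounded_fun_normP f : bounded_fun f <-> exists M, forall x, `|f x| <= M.
Proof.
split=> [[M [_ fM]]|[M fM]].
  by exists (M + 1) => x; apply: (fM (M + 1)) => //; rewrite ltrDl.
exists M; split; first exact: num_real.
by move=> N MN x _; exact: le_trans (fM x) (ltW MN).
Qed.

Lemma LIP_b_sub_star (m : {finite_measure set X -> \bar R}) :
  LIP_b `<=` LIP_star m.
Proof.
move=> f bf; have [b _] := bf; have [c c0 fc] := LIP_bP bf.
have lc x : (lip_a f x <= c%:E)%E.
  apply: le_trans (lip_a_le_Lip_ball f x ltr01) _.
  by apply/(Lip_leP _ _ c0) => *; exact: fc.
split => //.
  split; first exact: LIP_b_continuous.
  by move=> x; exact: le_lt_trans (lc x) (ltry _).
apply: (le_integrable measurableT (measurable_lip_a f) (g := cst c%:E)).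
  move=> x _ /=; rewrite gee0_abs ?lip_a_ge0//= (le_trans (lc x))// lee_fin.
  exact: ler_norm.
exact: finite_measure_integrable_cst.
Qed.

End asymptotic_slope.

(** * Relaxation of a function along chains of small mesh *)

Section chain_relaxation.
Context {R : realType} {d : measure_display} {X : borelMetricType R d}.
Variables (f rho : X -> R) (e M : R).
Hypotheses (e0 : 0 < e) (rho0 : forall x, 0 <= rho x)
  (fM : forall x, `|f x| <= M).
Implicit Types (x y z : X) (c : R).

(* [chain_cost x c] holds when some chain x_0, ..., x_n = x of mesh less than e
   has c = f x_0 + \sum_i rho x_i * mdist x_i x_i.+1. *)
Inductive chain_cost : X -> R -> Prop :=
| chain_start x : chain_cost x (f x)
| chain_step x y c : chain_cost x c -> mdist x y < e ->
    chain_cost y (c + rho x * mdist x y).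

Definition relax x := inf [set c | chain_cost x c].

Lemma chain_cost_ge x c : chain_cost x c -> - M <= c.
Proof.
elim=> {x c} [x|x y c _ Mc xy]; first by have := fM x; rewrite ler_norml => /andP[].
by rewrite (le_trans Mc)// lerDl mulr_ge0 ?mdist_ge0.
Qed.

Lemma relax_le_cost x c : chain_cost x c -> relax x <= c.
Proof. by move=> xc; apply: ge_inf => //; exists (- M) => ? /chain_cost_ge. Qed.

Lemma relax_ge x : - M <= relax x.
Proof.
apply: lb_le_inf; first by exists (f x); exact: chain_start.
by move=> c /chain_cost_ge.
Qed.

Lemma relax_lt_cost x t : relax x < t -> exists2 c, chain_cost x c & c < t.
Proof.
move=> xt; have [|c xc ct] := inf_lt _ xt; last by exists c.
by exists (f x); exact: chain_start.
Qed.

Lemma normr_relax x : `|relax x| <= M.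
Proof.
rewrite ler_norml relax_ge /= (le_trans (relax_le_cost (chain_start x)))//.
by rewrite (le_trans (ler_norm _)).
Qed.

(** A near-optimal chain ending at [x] is prolonged by the step to [y]. *)
Lemma relax_step x y : mdist x y < e ->
  relax y <= relax x + rho x * mdist x y.
Proof.
move=> xy; rewrite -lerBlDr; apply/ler_addgt0Pr => t t0.
have [c xc ct] := @relax_lt_cost x (relax x + t) ltac:(by rewrite ltrDl).
by rewrite (le_trans _ (ltW ct))// lerBlDr relax_le_cost//; exact: chain_step.
Qed.

Lemma relax_dist B x y : rho x <= B -> rho y <= B -> mdist x y < e ->
  `|relax x - relax y| <= B * mdist x y.
Proof.
move=> xB yB xy; have yx : mdist y x < e by rewrite metric_sym.
rewrite ler_norml lerNl opprB !lerBlDl; apply/andP; split.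
  by apply: le_trans (relax_step xy) _; rewrite lerD2l ler_wpM2r ?mdist_ge0.
rewrite (metric_sym x y).
by apply: le_trans (relax_step yx) _; rewrite lerD2l ler_wpM2r ?mdist_ge0.
Qed.

(** Below distance [e] a single step gives the constant [B]; from [e] on, the oscillation [2 * M] is
    at most [2 * M / e] times the distance. *)
Lemma relax_LIP_b B : (forall x, rho x <= B) -> LIP_b relax.
Proof.
move=> rB; split; first by apply/bounded_fun_normP; exists M; exact: normr_relax.
have M0 : 0 <= M by exact: le_trans (fM point).
have B0 : 0 <= B by exact: le_trans (rB point).
have D0 : 0 <= B + 2 * M / e by rewrite addr_ge0// divr_ge0 ?mulr_ge0// ltW.
apply: le_lt_trans (ltry (B + 2 * M / e)); apply/(Lip_leP _ _ D0) => x y _ _.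
have [xy|xy] := ltP (mdist x y) e.
  rewrite (le_trans (relax_dist (rB x) (rB y) xy))//.
  by rewrite ler_wpM2r ?mdist_ge0// lerDl divr_ge0 ?mulr_ge0// ltW.
apply: (@le_trans _ _ (2 * M)).
  rewrite (le_trans (ler_normB _ _))// mulr_natl mulr2n.
  by apply: lerD; exact: normr_relax.
rewrite -[leLHS](divfK (lt0r_neq0 e0)) [leRHS]mulrDl.
rewrite ler_wpDl ?mulr_ge0 ?mdist_ge0//.
by rewrite ler_wpM2l// divr_ge0 ?mulr_ge0// ltW.
Qed.

Lemma lip_a_relax x r : 0 < r -> (forall y, mdist x y < r -> rho y <= rho x) ->
  (lip_a relax x <= (rho x)%:E)%E.
Proof.
(* Since [s <= e / 2], a single step joins any two points of the ball. *)
move=> r0 rx; pose s := Num.min r (e / 2).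
have s0 : 0 < s by rewrite lt_min r0 divr_gt0.
apply: le_trans (lip_a_le_Lip_ball relax x s0) _.
apply/Lip_leP => // y z; rewrite !ballEmdist /= !lt_min.
move=> /andP[yr ye] /andP[zr ze]; apply: relax_dist; [exact: rx|exact: rx|].
rewrite [e]splitr (le_lt_trans (metric_triangle y x z))//.
by rewrite ltrD// metric_sym.
Qed.

(* The potentials u j decrease along a step by at most its cost, so the bad step
   lies where u j exceeds its final value by at most the total cost. *)
Lemma relax_bad_step (J : Type) (u : J -> X -> R) x :
    (forall j y z, mdist y z < e -> u j y <= u j z + rho y * mdist y z) ->
    relax x < f x ->
  exists y z, [/\ mdist y z < e, rho y * mdist y z < f z - f y &
    forall j, u j y <= u j x + 2 * M].
Proof.
move=> uP /relax_lt_cost[c xc cx].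
(* Here [c'] is the cost of the chain up to [y]; the rest costs [c - c'], at most [2 * M] because
   [c < f x <= M] and [- M <= c']. *)
suff [y [z [c' [yz bad Mc' uy]]]] : exists y z c', [/\ mdist y z < e,
    rho y * mdist y z < f z - f y, - M <= c' & forall j, u j y <= u j x + c - c'].
  exists y, z; split => // j; apply: le_trans (uy j) _.
  have /ler_normlP[_ fxM] := fM x; lra.
elim: xc cx => {x c} [x|x y c xc IH xy cy]; first by rewrite ltxx.
(* If the chain is already too cheap before its last step, the bad step lies earlier; otherwise the
   last step is bad. *)
have [cx|cx] := ltP c (f x).
  have [y' [z' [c' [yz bad Mc' uy]]]] := IH cx.
  exists y', z', c'; split => // j; have := uy j; have := uP j _ _ xy; lra.
exists x, y, c; split => //; [lra|exact: chain_cost_ge xc|].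
by move=> j; have := uP j _ _ xy; lra.
Qed.

End chain_relaxation.

(** * Distance to a set and convergence near compact sets *)

Section distance_to_set.
Context {R : realType} {X : metricType R}.
Implicit Types (A : set X) (x y : X) (r : R).

Definition dist_to A x := inf [set mdist x a | a in A].

Lemma dist_to_le A x a : A a -> dist_to A x <= mdist x a.
Proof.
move=> Aa; apply: ge_inf; last by exists a.
by exists 0 => _ [b _ <-]; exact: mdist_ge0.
Qed.

Lemma dist_to_lt A x r : A !=set0 -> dist_to A x < r ->
  exists2 a, A a & mdist x a < r.
Proof.
move=> [a Aa] xr; have [|_ [b Ab <-] br] := inf_lt _ xr; last by exists b.
by exists (mdist x a); exists a.
Qed.

Lemma dist_to_lipschitz A x y : A !=set0 ->
  dist_to A x <= dist_to A y + mdist x y.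
Proof.
move=> A0; apply/ler_addgt0Pr => t t0.
have [a Aa ya] := @dist_to_lt A y (dist_to A y + t) A0 ltac:(by rewrite ltrDl).
apply: le_trans (dist_to_le x Aa) _.
have := metric_triangle x y a; lra.
Qed.

(** This differs from [r <= dist_to A x] for empty [A]: [far A r] is then the whole space, whereas
    [dist_to A x] is 0 by convention. It matters below, where the slope bound forces [C 0] to be
    empty. *)
Definition far A r := [set x | forall a, A a -> r <= mdist x a].

Lemma closed_far A r : closed (far A r).
Proof.
rewrite (_ : far A r = \bigcap_(a in A) ~` ball a r); last first.
  apply/seteqP; split=> x xA a Aa.
    by rewrite ballEmdist /= metric_sym; apply/negP; rewrite -leNgt; exact: xA.
  have := xA a Aa; rewrite ballEmdist /= metric_sym => /negP.
  by rewrite -leNgt.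
apply: closed_bigI => a Aa; apply: open_closedC.
rewrite openE => x; rewrite ballEmdist /= => ax.
apply/nbhs_ballP; exists (r - mdist a x); first by rewrite /= subr_gt0.
move=> y; rewrite !ballEmdist /= ltrBrDl; exact/le_lt_trans/metric_triangle.
Qed.

(* Ultrafilters replace the extraction of subsequences; the limits of the
   projections on the compact sets form a Cauchy sequence. *)
Lemma ultra_near_compact_cvg (G : set_system nat) (y : nat -> X) :
    UltraFilter G -> metric_complete X ->
    (forall e, 0 < e -> exists2 K, compact K &
      G [set n | exists2 a, K a & mdist (y n) a < e]) ->
  exists l : X, y @ G --> l.
Proof.
move=> UG cX yK.
have yc i : exists c, G [set n | mdist (y n) c < i.+1%:R^-1].
  have i0 : 0 < i.+1%:R^-1 / 2 :> R by rewrite divr_gt0.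
  have [K cK GK] := yK _ i0.
  (* [q n] is a point of [K] close to [y n], with dummy value [y n] when there is none. *)
  have /choice[q qP] : forall n, exists a, (exists2 a, K a &
      mdist (y n) a < i.+1%:R^-1 / 2) -> K a /\ mdist (y n) a < i.+1%:R^-1 / 2.
    move=> n; have [[a Ka ya]|h] := pselect (exists2 a, K a &
      mdist (y n) a < i.+1%:R^-1 / 2); first by exists a.
    by exists (y n) => /h.
  have [c [_ clc]] := cK (q @ G) _ (filterS (fun n h => (qP n h).1) GK).
  exists c.
  (* The ultrafilter contains the indices with [q n] in the ball or those with [q n] outside; the
     latter contradicts that [c] is a cluster point. *)
  have [GB|GB] := in_ultra_setVsetC (q @^-1` ball c (i.+1%:R^-1 / 2)) UG.
    apply: filterS (filterI GK GB) => n [/qP[_ yq]] /=.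
    rewrite ballEmdist /= metric_sym => qc.
    rewrite [_^-1]splitr (le_lt_trans (metric_triangle _ (q n) _))//.
    by rewrite ltrD.
  by have [p []] := clc (~` ball c (i.+1%:R^-1 / 2)) _ GB (nbhsx_ballx c _ i0).
have [c cP] := choice yc.
(* Two members of [G] meet, so some [y n] is close to both centres. *)
have cc i j : mdist (c i) (c j) < i.+1%:R^-1 + j.+1%:R^-1.
  have [n [/= yi yj]] := filter_ex (filterI (cP i) (cP j)).
  rewrite (le_lt_trans (metric_triangle _ (y n) _))// ltrD//.
  by rewrite metric_sym.
have [l cl] : exists l : X, c @ \oo --> l.
  apply: cX; apply/cauchy_exP => e e0.
  have e20 : 0 < e / 2 by rewrite divr_gt0.
  have ie := near_infty_natSinv_lt (PosNum e20).
  have [i /= ie2] := filter_ex ie.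
  exists (c i); apply: filterS ie => j /= je2; rewrite ballEmdist /=.
  by rewrite [e]splitr (lt_trans (cc i j))// ltrD.
exists l; apply/metricType_numDomainType.cvgrPdist_lt => e e0.
have e20 : 0 < e / 2 by rewrite divr_gt0.
have /metricType_numDomainType.cvgrPdist_lt/(_ _ e20) cle := cl.
have [i [li ie]] := filter_ex (filterI cle (near_infty_natSinv_lt (PosNum e20))).
apply: filterS (cP i) => n /= yci.
rewrite [e]splitr (le_lt_trans (metric_triangle _ (c i) _))// ltrD//.
by rewrite metric_sym (lt_trans yci).
Qed.

End distance_to_set.

(** * Relaxation with a staircase weight *)

Section staircase_relaxation.
Context {R : realType} {d : measure_display} {X : borelMetricType R d}.
Variables (f : X -> R) (M delta : R) (C : nat -> set X).
Hypotheses (fM : forall x, `|f x| <= M) (delta0 : 0 < delta).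
Hypotheses (compactC : forall k, compact (C k))
  (C_nondecreasing : forall i j, (i <= j)%N -> C i `<=` C j)
  (slopeC : forall k x, C k x -> (lip_a f x < (delta * k%:R)%:E)%E).
Implicit Types (x y : X) (n k : nat).

Definition staircase n x : R :=
  delta * \sum_(k < n) \1_(far (C k) n.+1%:R^-1) x.

Lemma staircase_ge0 n x : 0 <= staircase n x.
Proof.
by apply: mulr_ge0; [exact: ltW|by apply: sumr_ge0 => k _; rewrite indicE].
Qed.

Lemma staircase_le n x : staircase n x <= delta * n%:R.
Proof.
rewrite ler_pM2l// -[n in leRHS]card_ord -sum1_card natr_sum.
by apply: ler_sum => k _; rewrite indicE lern1 leq_b1.
Qed.

(** By monotonicity of [C], a point far from [C k] is far from every [C i] with [i <= k], so [k + 1]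
    terms equal 1. *)
Lemma staircase_ge n k x : (k < n)%N -> far (C k) n.+1%:R^-1 x ->
  delta * k.+1%:R <= staircase n x.
Proof.
move=> kn xk; rewrite ler_pM2l// -[k.+1 in leLHS]card_ord -sum1_card natr_sum.
rewrite (big_ord_widen n (fun=> 1) kn) big_mkcond ler_sum// => i _.
rewrite indicE; case: ifP => // ik; rewrite mem_set//= => a.
by move/(C_nondecreasing (ik : (i <= k)%N)); exact: xk.
Qed.

(** Near [x] the indicator of a closed set is at most its value at [x], and finite sums keep this
    exact bound, which [lip_a_relax] requires. *)
Lemma staircase_usc n x : exists2 r, 0 < r &
  forall y, mdist x y < r -> staircase n y <= staircase n x.
Proof.
have : \forall y \near x, forall k : 'I_n,
    (\1_(far (C k) n.+1%:R^-1) y : R) <= \1_(far (C k) n.+1%:R^-1) x.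
  apply: filter_forall => k; have [xk|xk] := pselect (far (C k) n.+1%:R^-1 x).
    by near=> y; rewrite !indicE (mem_set xk) lern1 leq_b1.
  have : nbhs x (~` far (C k) n.+1%:R^-1).
    by apply: open_nbhs_nbhs; split => //; apply: closed_openC; exact: closed_far.
  by apply: filterS => y yk; rewrite !indicE memNset// ler0n.
move=> /nbhs_ballP[r /= r0 xr]; exists r => // y xy.
rewrite ler_pM2l// ler_sum// => k _; apply: xr.
by rewrite ballEmdist.
Unshelve. all: by end_near. Qed.

Definition staircase_relax n := relax f (staircase n) n.+1%:R^-1.

(** Its decrease along a step is paid for by the weight. It is 0 for [n <= j], where the staircase
    has no term for [C j], and the offset [1 / (n + 1)] makes it vanish wherever that term does. *)
Let potential n (j : nat) x : R := if (j < n)%N then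
  delta * j.+1%:R * Num.max 0 (dist_to (C j) x - n.+1%:R^-1) else 0.

Let potential_step n j y z : C j !=set0 -> mdist y z < n.+1%:R^-1 ->
  potential n j y <= potential n j z + staircase n y * mdist y z.
Proof.
move=> Cj yz; rewrite /potential; case: ifP => jn; last first.
  by rewrite add0r mulr_ge0 ?mdist_ge0 ?staircase_ge0.
have dj0 : 0 <= delta * j.+1%:R by rewrite mulr_ge0// ltW.
have max0 t : 0 <= Num.max 0 t :> R by rewrite le_max lexx.
have [yj|yj] := pselect (far (C j) n.+1%:R^-1 y).
  have /(ler_wpM2r (mdist_ge0 y z)) := staircase_ge jn yj.
  rewrite -(lerD2l (delta * j.+1%:R * Num.max 0 (dist_to (C j) z - n.+1%:R^-1))).
  apply: le_trans; rewrite -mulrDr ler_wpM2l// ge_max addr_ge0 ?mdist_ge0//=.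
  rewrite lerBlDr (le_trans (dist_to_lipschitz y z Cj))// addrAC lerD2r.
  by rewrite -lerBlDr le_max lexx orbT.
have [a [Ca ya]] : exists a, C j a /\ mdist y a < n.+1%:R^-1.
  apply: contrapT => h; apply: yj => a Ca; rewrite leNgt; apply/negP => ya.
  by apply: h; exists a.
rewrite max_l; last by rewrite subr_le0 ltW// (le_lt_trans (dist_to_le y Ca)).
rewrite mulr0; apply: addr_ge0; apply: mulr_ge0;
  by rewrite ?max0 ?staircase_ge0 ?mdist_ge0.
Qed.

Let bad n y z := mdist y z < n.+1%:R^-1 /\
  staircase n y * mdist y z < f z - f y.

Lemma staircase_bad_step n k x : C k x -> staircase_relax n x < f x ->
  exists y z, bad n y z /\ forall j, (k <= j < n)%N ->
    delta * j.+1%:R * (dist_to (C j) y - n.+1%:R^-1) <= 2 * M.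
Proof.
(* For [k <= j] the point [x] lies in [C j], so [C j] is nonempty and the potential vanishes at
   [x]. *)
move=> Ckx xf; pose J := {j | (k <= j)%N}.
have CJ (j : J) : C (sval j) x by case: j => j /= /C_nondecreasing; apply.
have [|y [z [yz ryz uy]]] := @relax_bad_step _ _ _ f (staircase n) n.+1%:R^-1 M
  (staircase_ge0 n) fM J (fun j => potential n (sval j)) x _ xf.
  by move=> j y z yz; apply: potential_step => //; exists x.
exists y, z; split => // j /andP[kj jn].
have := uy (exist _ j kj); rewrite /potential jn /=.
rewrite [X in _ * X + _]max_l ?mulr0 ?add0r; last first.
  by rewrite subr_le0 (le_trans (dist_to_le x (CJ (exist _ j kj))))// mdistxx.
by apply: le_trans; rewrite ler_wpM2l ?le_max ?lexx ?orbT// mulr_ge0// ltW.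
Qed.

Lemma near_no_bad_step l : (lip_a f l < +oo)%E ->
  exists2 r, 0 < r &
    \forall n \near \oo, forall y z, mdist l y < r -> ~ bad n y z.
Proof.
move=> lfin; have lE : lip_a f l = (fine (lip_a f l))%:E.
  by rewrite fineK// ge0_fin_numE ?lip_a_ge0.
have exk : exists k, (lip_a f l < (delta * k%:R)%:E)%E.
  exists (Num.truncn (fine (lip_a f l) / delta)).+1.
  by rewrite lE lte_fin mulrC -ltr_pdivrMr// truncnS_gt.
(* Slopes are nonnegative, so the minimal index is a successor [k.+1], and minimality keeps [l] out
   of [C k]. *)
case: (ex_minnP exk) => -[|k] lk kmin.
  by move: lk; rewrite mulr0 ltNge lip_a_ge0.
have lCk : ~ C k l by move=> /slopeC/kmin; rewrite ltnn.
have : nbhs l (~` C k).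
  apply: open_nbhs_nbhs; split => //; apply: closed_openC.
  by have [] := compact_closed_measurable (@compactC k).
move=> /nbhs_ballP[s /= s0 ls]; have [r r0 rk] := lip_a_lt lk.
(* A step shorter than [t] from a point within [t] of [l] stays in the ball of radius [r], where [f]
   is Lipschitz, and its origin is at distance at least [t] from [C k], which avoids the ball of
   radius [s]. *)
pose t : R := Num.min r s / 2; have t0 : 0 < t by rewrite divr_gt0// lt_min r0.
have tr : t + t <= r by rewrite -splitr ge_min lexx.
have ts : t + t <= s by rewrite -splitr ge_min lexx orbT.
clearbody t; exists t => //; near=> n => y z ly [yz].
have nt : n.+1%:R^-1 < t by near: n; exact: (near_infty_natSinv_lt (PosNum t0)).
have kn : (k < n)%N by near: n; exact: nbhs_infty_gt.
apply/negP; rewrite -leNgt; apply: (@le_trans _ _ (delta * k.+1%:R * mdist y z)).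
  rewrite (le_trans (ler_norm _))// distrC.
  have dk0 : 0 <= delta * k.+1%:R by rewrite mulr_ge0// ltW.
  apply: (Lip_leP f (ball l r) dk0).1; first exact: ltW.
    by rewrite ballEmdist /=; lra.
  rewrite ballEmdist /=.
  by have := metric_triangle l y z; have := lt_trans yz nt; lra.
rewrite ler_wpM2r ?mdist_ge0// staircase_ge// => a Ca.
have las : s <= mdist l a.
  by rewrite leNgt; apply/negP => la; apply: (ls a) => //; rewrite ballEmdist.
apply: (le_trans (ltW nt)); have := metric_triangle l y a; lra.
Unshelve. all: by end_near. Qed.

Hypotheses (completeX : metric_complete X)
  (slope_fin : forall x, (lip_a f x < +oo)%E).

Lemma staircase_relax_eventually k x : C k x ->
  \forall n \near \oo, staircase_relax n x = f x.
Proof.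
move=> Ckx; suff : \forall n \near \oo, ~ staircase_relax n x < f x.
  apply: filterS => n /negP; rewrite -leNgt => fx; apply/eqP.
  rewrite eq_le fx andbT.
  apply: (relax_le_cost (staircase_ge0 n) fM); exact: chain_start.
(* If the claim fails, the bad indices are cofinal, and some ultrafilter contains them and every
   tail. *)
set A := [set n | ~ staircase_relax n x < f x]; apply: contrapT => nA.
have WF : ProperFilter (within (~` A) \oo).
  apply: Build_ProperFilter_ex => B BA; apply: contrapT => nB; apply: nA.
  move: BA; rewrite /within /=; apply: filterS => n nAB.
  by apply: contrapT => An; apply: nB; exists n; exact: nAB.
have [G [UG WG]] := ultraFilterLemma WF.
have GA : G (~` A) by apply: WG; rewrite /within /=; near=> n.
have Goo B : (\forall n \near \oo, B n) -> G B.
  move=> ooB; apply: WG; rewrite /within /=.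
  by apply: filterS ooB => n.
have /choice[yz yzP] : forall n, exists p, (~` A) n -> bad n p.1 p.2 /\
    forall j, (k <= j < n)%N ->
    delta * j.+1%:R * (dist_to (C j) p.1 - n.+1%:R^-1) <= 2 * M.
  move=> n; have [An|nAn] := pselect (A n); first by exists (x, x) => /(_ An).
  have /contrapT/(staircase_bad_step Ckx)[y [z yzP]] := nAn.
  by exists (y, z).
have [e e0|l yl] := ultra_near_compact_cvg (y := fst \o yz) UG completeX.
  have e20 : 0 < e / 2 by rewrite divr_gt0.
  (* For this [j] the cost bound [2 * M] leaves [y n] less than [e / 2 + 1 / (n + 1)] from [C j]. *)
  pose j := (k + Num.truncn (2 * M / (delta * (e / 2))))%N.
  have jP : 2 * M < delta * j.+1%:R * (e / 2).
    rewrite [ltRHS]mulrAC [ltRHS]mulrC -ltr_pdivrMr ?mulr_gt0//.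
    by rewrite (lt_le_trans (truncnS_gt _))// ler_nat ltnS leq_addl.
  exists (C j) => //.
  have G1 := Goo _ (nbhs_infty_gt j).
  have G2 := Goo _ (near_infty_natSinv_lt (PosNum e20)).
  apply: filterS (filterI GA (filterI G1 G2)) => n [/yzP[_ yj] [jn /= ne]].
  apply: dist_to_lt.
    by exists x; apply: C_nondecreasing Ckx; rewrite leq_addr.
  have dj0 : 0 < delta * j.+1%:R by rewrite mulr_gt0.
  have := yj j; rewrite leq_addr jn => /(_ isT) /le_lt_trans/(_ jP).
  by rewrite ltr_pM2l// ltrBlDr => /lt_trans -> //; rewrite [ltRHS]splitr ltrD2l.
have [r r0 lr] := near_no_bad_step (slope_fin l).
have /metricType_numDomainType.cvgrPdist_lt/(_ _ r0) lyr := yl.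
have [n [/yzP[badn _] [ln nb]]] := filter_ex (filterI GA (filterI lyr (Goo _ lr))).
exact: nb badn.
Unshelve. all: by end_near. Qed.

End staircase_relaxation.

(** * Approximation in energy by bounded Lipschitz functions *)

Section lipschitz_approximation.
Context {R : realType} {d : measure_display} {X : borelMetricType R d}.
Variable m : {finite_measure set X -> \bar R}.
Hypothesis radonm : radon m.
Implicit Types (f g : X -> R) (E : set X) (e t : R).

Lemma finite_measure_lt_pinfty E : measurable E -> (m E < +oo)%E.
Proof. by move=> mE; rewrite -ge0_fin_numE ?measure_ge0 ?fin_num_measure. Qed.

Lemma radon_inner_compact E t : measurable E -> 0 < t ->
  exists K, [/\ compact K, K `<=` E & (m (E `\` K) <= t%:E)%E].
Proof.
move=> mE t0; have Efin : m E \is a fin_num by exact: fin_num_measure.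
have : (m E - t%:E < ereal_sup [set m K | K in [set K | compact K /\ K `<=` E]])%E.
  by rewrite -radonm// lteBlDr// lteDl// lte_fin.
move=> /ereal_sup_gt[_ [K [cK KE] <-] EK]; exists K; split => //.
have [_ mK] := compact_closed_measurable cK.
rewrite measureD//; last exact: finite_measure_lt_pinfty.
rewrite setIidr// leeBlDr ?fin_num_measure// addeC -leeBlDr//.
exact: ltW.
Qed.

Lemma sum_half_pow_le1 n : \sum_(k < n) 2^-1 ^+ k.+1 <= 1 :> R.
Proof.
suff -> : \sum_(k < n) 2^-1 ^+ k.+1 = 1 - 2^-1 ^+ n :> R.
  by rewrite gerBl exprn_ge0.
elim: n => [|n IH]; first by rewrite big_ord0 expr0 subrr.
by rewrite big_ord_recr /= IH exprS; lra.
Qed.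

(** At most [h / delta + 1] integers [k >= 0] satisfy [delta * k <= h]; the extra [delta] is due to
    [k = 0]. *)
Lemma level_count_le (delta h : R) n : 0 < delta -> 0 <= h ->
  delta * \sum_(k < n) (delta * k%:R <= h)%R%:R <= h + delta.
Proof.
move=> delta0 h0; elim: n => [|n IH].
  by rewrite big_ord0 mulr0 addr_ge0// ltW.
rewrite big_ord_recr /=; have [nh|_] := leP (delta * n%:R) h; last first.
  by rewrite addr0.
apply: (@le_trans _ _ (delta * (n%:R + 1))); last by rewrite mulrDr mulr1 lerD2r.
rewrite ler_pM2l// lerD2r -[n in leRHS]card_ord -sum1_card natr_sum.
by apply: ler_sum => k _; rewrite lern1 leq_b1.
Qed.

Hypothesis completeX : metric_complete X.

Lemma LIP_star_exhaustion f (delta : R) : 0 < delta -> exists C : nat -> set X,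
  [/\ forall k, compact (C k), forall i j, (i <= j)%N -> C i `<=` C j,
      forall k x, C k x -> (lip_a f x < (delta * k%:R)%:E)%E &
      forall k, (m ([set x | lip_a f x < (delta * k%:R)%:E]%E `\` C k) <=
        (2^-1 ^+ k.+1)%:E)%E].
Proof.
move=> delta0; pose E k := [set x | lip_a f x < (delta * k%:R)%:E]%E.
have mE k : measurable (E k).
  by apply: borel_open_measurable; exact: open_lip_a_lt.
have /choice[K KP] : forall k, exists K, [/\ compact K, K `<=` E k &
    (m (E k `\` K) <= (2^-1 ^+ k.+1)%:E)%E].
  by move=> k; apply: radon_inner_compact => //; rewrite exprn_gt0.
pose C k := \big[setU/set0]_(i < k.+1) K i.
have cC k : compact (C k) by apply: bigsetU_compact => i _; have [] := KP i.
exists C; split => //.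
- move=> i j ij; rewrite /C -!bigcup_mkord => x [l /= li Klx].
  by exists l => //=; exact: leq_trans li _.
- move=> k x; rewrite /C -bigcup_mkord => -[i /= ik Kix].
  have [_ /(_ x Kix) Eix _] := KP i; apply: lt_le_trans Eix _.
  by rewrite lee_fin ler_pM2l// ler_nat.
move=> k; rewrite -/(E k); have [cK _ mK] := KP k; apply: le_trans mK.
have [_ mKk] := compact_closed_measurable cK.
have [_ mCk] := compact_closed_measurable (@cC k).
apply: le_measure; rewrite ?inE; [exact: measurableD|exact: measurableD|].
apply: setDS; rewrite /C -bigcup_mkord; by move=> x Kkx; exists k => /=.
Qed.

Lemma LIP_b_approximation f e : LIP_star m f -> 0 < e ->
  exists g, [/\ LIP_b g, (\int[m]_x `|(g x - f x)%:E| <= e%:E)%E &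
    (\int[m]_x lip_a g x <= \int[m]_x lip_a f x + e%:E)%E].
Proof.
move=> [/bounded_fun_normP[M fM] [cf lf] intf] e0.
have mX : m setT \is a fin_num by exact: fin_num_measure.
(* Then [delta * m X + delta = e]: the first term pays for rounding the slope, the second for the
   sets [E k \ C k], of total measure at most 1. *)
pose delta := e / (fine (m setT) + 1).
have mX1 : 0 < fine (m setT) + 1 by rewrite ltr_wpDl// fine_ge0.
have delta0 : 0 < delta by rewrite divr_gt0.
have [C [cC Cmono slopeC mC]] := LIP_star_exhaustion f delta0.
pose E k := [set x | lip_a f x < (delta * k%:R)%:E]%E.
have mE k : measurable (E k).
  by apply: borel_open_measurable; exact: open_lip_a_lt.
have mCk k : measurable (C k) by have [] := compact_closed_measurable (@cC k).
have mD k : measurable (E k `\` C k) by exact: measurableD.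
pose g n := staircase_relax f delta C n.
have gb n : LIP_b (g n).
  apply: (relax_LIP_b _ (staircase_ge0 C delta0 n) fM (staircase_le C delta0 n)).
  by rewrite invr_gt0.
(* The term of index [k] is nonzero only off [C k]: either [delta * k <= lip_a f x], which
   [level_count_le] counts, or [x] lies in [E k \ C k]. *)
have slope_le n x : (lip_a (g n) x <= lip_a f x + (delta%:E +
    delta%:E * \sum_(k < n) (\1_(E k `\` C k) x)%:E))%E.
  have [r r0 xr] := staircase_usc C delta0 n x.
  apply: le_trans (lip_a_relax (e := n.+1%:R^-1) _
    (staircase_ge0 C delta0 n) fM r0 xr) _.
    by rewrite invr_gt0.
  have lE : lip_a f x = (fine (lip_a f x))%:E.
    by rewrite fineK// ge0_fin_numE ?lip_a_ge0.
  have h0 : 0 <= fine (lip_a f x) by rewrite fine_ge0// lip_a_ge0.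
  rewrite lE sumEFin -EFinM -!EFinD lee_fin addrA.
  apply: le_trans (lerD (level_count_le n delta0 h0) (lexx _)).
  rewrite -mulrDr ler_pM2l// -big_split ler_sum// => k _ /=.
  rewrite !indicE -lee_fin; have [xE|xE] := leP (delta * k%:R) _.
    by rewrite lee_fin (@le_trans _ _ 1)// ?lern1 ?leq_b1// lerDl.
  rewrite add0r lee_fin ler_nat; case: (pselect (C k x)) => Ckx.
    rewrite memNset// => /(_ x Ckx); rewrite mdistxx leNgt invr_gt0 ltr0n//.
  rewrite (@mem_set _ (E k `\` C k)) ?leq_b1//; split => //.
  by rewrite /E /= lE lte_fin.
have intD n : (\int[m]_x lip_a (g n) x <= \int[m]_x lip_a f x + e%:E)%E.
  have mlf := measurable_lip_a f.
  have mI k : measurable_fun setT (fun x => (\1_(E k `\` C k) x)%:E : \bar R).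
    by apply/measurable_EFinP; exact: measurable_indic.
  have mS : measurable_fun setT
      (fun x => \sum_(k < n) (\1_(E k `\` C k) x)%:E : \bar R)%E.
    by apply: emeasurable_sum => k; exact: mI.
  have mdS : measurable_fun setT
      (fun x => delta%:E * \sum_(k < n) (\1_(E k `\` C k) x)%:E : \bar R)%E.
    exact: measurable_funeM.
  have S0 x : (0 <= \sum_(k < n) (\1_(E k `\` C k) x)%:E :> \bar R)%E.
    by apply: sume_ge0 => k _; rewrite lee_fin.
  have dS0 x : (0 <= delta%:E * \sum_(k < n) (\1_(E k `\` C k) x)%:E :> \bar R)%E.
    by rewrite mule_ge0// lee_fin ltW.
  apply: (@le_trans _ _ (\int[m]_x (lip_a f x + (delta%:E +
      delta%:E * \sum_(k < n) (\1_(E k `\` C k) x)%:E)))%E).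
    apply: ge0_le_integral => //.
    - by move=> x _; exact: lip_a_ge0.
    - exact: measurable_lip_a.
    - by apply: emeasurable_funD => //; exact: emeasurable_funD.
  rewrite ge0_integralD//; first last.
  - by apply: emeasurable_funD.
  - by move=> x _; rewrite adde_ge0// lee_fin ltW.
  - by move=> x _; exact: lip_a_ge0.
  rewrite leeD2l// ge0_integralD//; last by move=> x _; rewrite lee_fin ltW.
  rewrite integral_cst// ge0_integralZl ?lee_fin ?(ltW delta0)//.
  rewrite ge0_integral_sum//.
  apply: (@le_trans _ _ (delta%:E * m setT + delta%:E * 1)%E).
    rewrite leeD2l// lee_pmul2l ?lte_fin//.
    apply: le_trans (_ : (_ <= (\sum_(k < n) 2^-1 ^+ k.+1)%:E)%E) _; last first.
      by rewrite lee_fin sum_half_pow_le1.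
    rewrite -sumEFin; apply: lee_sum => k _.
    rewrite integral_indic// setIT; exact: mC.
  rewrite -(fineK mX) mule1 -EFinM -EFinD lee_fin -[X in _ + X]mulr1 -mulrDr.
  by rewrite /delta divfK// lt0r_neq0.
(* Finite slopes put each point in some [E k], and the part of [E k] missed by all the compact sets
   lies in [E j \ C j] for every [j >= k], hence is null. *)
have cvg_ae : {ae m, forall x, setT x ->
    (EFin \o g n) x @[n --> \oo] --> (EFin \o f) x}.
  pose N := ~` \bigcup_k C k.
  have mN : measurable N by apply: measurableC; exact: bigcup_measurable.
  apply: (@negligibleS _ _ _ _ (\bigcup_k (E k `&` N))).
    move=> x /= xcvg; have [k _ xk] : (\bigcup_k E k) x.
      exists (Num.truncn (fine (lip_a f x) / delta)).+1 => //=.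
      have lE : lip_a f x = (fine (lip_a f x))%:E.
        by rewrite fineK// ge0_fin_numE ?lip_a_ge0.
      by rewrite /E /= [ltLHS]lE lte_fin mulrC -ltr_pdivrMr// truncnS_gt.
    exists k => //; split => // -[j _ Cjx]; apply: xcvg => _.
    apply/cvg_EFin; first by near=> n.
    apply: cvg_near_cst.
    exact: staircase_relax_eventually Cjx.
  apply: negligible_bigcup => k; exists (E k `&` N); split => //.
    exact: measurableI.
  apply/eqP; rewrite eq_le measure_ge0 andbT; apply/lee_addgt0Pr => t t0.
  rewrite add0e.
  have [j [kj jt]] : exists j, (k <= j)%N /\ 2^-1 ^+ j.+1 < t.
    have [j [kj jt]] := filter_ex
      (filterI (nbhs_infty_ge k) (near_infty_natSinv_lt (PosNum t0))).
    exists j; split => //; apply: le_lt_trans jt.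
    rewrite exprVn lef_pV2 ?posrE ?exprn_gt0// -natrX ler_nat ltnW//.
    exact: ltn_expl.
  apply: le_trans (le_trans (mC j) _); last by rewrite lee_fin ltW.
  apply: le_measure; rewrite ?inE; [exact: measurableI|exact: mD|].
  move=> x [Ekx Nx]; split; last by move=> Cjx; apply: Nx; exists j.
  rewrite /E /= in Ekx *; apply: lt_le_trans Ekx _.
  by rewrite lee_fin ler_pM2l// ler_nat.
have [] := @dominated_convergence _ _ _ m setT measurableT
  (fun n => EFin \o g n) (EFin \o f) (cst M%:E).
- move=> n; apply/measurable_EFinP; apply: continuous_borel_measurable.
  exact: LIP_b_continuous.
- by apply/measurable_EFinP; exact: continuous_borel_measurable.
- exact: cvg_ae.
- exact: finite_measure_integrable_cst.
- apply: aeW => x n _ /=; rewrite lee_fin.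
  by apply: normr_relax; [exact: staircase_ge0|exact: fM].
move=> _ cvg0 _.
have nbhs0e : nbhs (0%:E : \bar R) [set y | y < e%:E]%E.
  by apply: open_nbhs_nbhs; split; [exact: open_ereal_lt_ereal|rewrite /= lte_fin].
have [n /= /ltW gn] := filter_ex (cvg0 _ nbhs0e : \forall n \near \oo, _).
by exists (g n); split.
Unshelve. all: by end_near. Qed.

End lipschitz_approximation.

(** Once [1 / (n + 1) < t], each tail infimum of [v] is at most that of [u] plus [t]. *)
Lemma limn_einf_le_perturb (R : realType) (u v : nat -> \bar R) :
  (forall n, (v n <= u n + n.+1%:R^-1%:E)%E) ->
  (limn_einf v <= limn_einf u)%E.
Proof.
move=> vu; apply/lee_addgt0Pr => t t0.
rewrite addeC -limn_einf_shift// !limn_einf_lim.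
apply: lee_lim; [exact: is_cvg_einfs|exact: is_cvg_einfs|].
apply: filterS (near_infty_natSinv_lt (PosNum t0)) => n /= nt.
apply: le_ereal_inf_tmp => _ [k /= nk <-].
apply: (@le_trans _ _ (v k)); first by apply: ereal_inf_lbound; exists k.
rewrite (le_trans (vu k))// addeC leeD2r// lee_fin (le_trans _ (ltW nt))//.
by rewrite lef_pV2 ?posrE// ler_nat.
Qed.

Lemma cvg_natSinv_EFin (R : realType) :
  (n.+1%:R^-1%:E : \bar R) @[n --> \oo] --> 0%E.
Proof.
by apply/cvg_EFin; [near=> n|exact: cvg_harmonic].
Unshelve. all: by end_near. Qed.

(** * Diagonal argument and conclusion *)

Section diagonal_argument.
Context {R : realType} {d : measure_display} {X : borelMetricType R d}.
Variable m : {finite_measure set X -> \bar R}.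
Hypotheses (radonm : radon m) (completeX : metric_complete X).
Implicit Types (f : X -> R).

(** Each [g n] is replaced by a bounded Lipschitz function with error [1 / (n + 1)]; the triangle
    inequality preserves the limit. *)
Lemma L1_approx_LIP_b f (g : nat -> X -> R) :
    measurable_fun setT f -> L1_approx m (LIP_star m) f g ->
  exists2 h, L1_approx m LIP_b f h & forall n,
    (\int[m]_x lip_a (h n) x <= \int[m]_x lip_a (g n) x + n.+1%:R^-1%:E)%E.
Proof.
move=> mf [sg gf].
have n0 n : 0 < n.+1%:R^-1 :> R by rewrite invr_gt0.
have [h hP] := choice (fun n => LIP_b_approximation radonm completeX (sg n) (n0 n)).
exists h => [|n]; last by have [] := hP n.
split=> [n|]; first by have [] := hP n.
have mg n : measurable_fun setT (g n).
  by apply: continuous_borel_measurable; have [_ []] := sg n.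
have mh n : measurable_fun setT (h n).
  apply: continuous_borel_measurable; apply: LIP_b_continuous.
  by have [] := hP n.
have mabs (u v : X -> R) : measurable_fun setT u -> measurable_fun setT v ->
    measurable_fun setT (fun x => `|(u x - v x)%:E|%E).
  move=> mu mv; apply: measurableT_comp => //; apply/measurable_EFinP.
  exact: measurable_funB.
apply: (@squeeze_cvge _ _ _ _ (cst 0%E) _
    (fun n => n.+1%:R^-1%:E + \int[m]_x `|(g n x - f x)%:E|)%E).
- apply: nearW => n; rewrite integral_ge0//=.
  have [_ hg _] := hP n; apply: le_trans (leeD2r _ hg).
  rewrite -ge0_integralD//; [|exact: mabs|exact: mabs].
  apply: ge0_le_integral => //; [exact: mabs| |].
    by apply: emeasurable_funD; exact: mabs.
  move=> x _; rewrite -EFinD lee_fin.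
  by rewrite (le_trans _ (ler_normD _ _))// subrKA.
- exact: cvg_cst.
- rewrite -[X in _ --> X]adde0; apply: cvgeD => //; exact: cvg_natSinv_EFin.
Qed.

End diagonal_argument.

Theorem proposition3p5 (R : realType) (d : measure_display)
    (X : borelMetricType R d) (m : {finite_measure set X -> \bar R}) :
  radon m -> metric_complete X ->
  BV_H m (LIP_star m) = BV_H m LIP_b /\
  (forall f : X -> R, BV_H m (LIP_star m) f ->
    Dstar m LIP_b f = Dstar m (LIP_star m) f).
Proof.
move=> radonm completeX.
have L1_sub f g : L1_approx m LIP_b f g -> L1_approx m (LIP_star m) f g.
  by move=> [gA gf]; split => // n; apply: LIP_b_sub_star; exact: gA.
have mEFin f : m.-integrable setT (EFin \o f) -> measurable_fun setT f.
  by move=> /measurable_int/measurable_EFinP.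
split.
  apply/seteqP; split=> f [intf [g gf gfin]]; split => //; last first.
    by exists g; first exact: L1_sub.
  have [h hf hg] := L1_approx_LIP_b radonm completeX (mEFin f intf) gf.
  exists h; first exact: hf.
  (* The added 1 absorbs all the errors [1 / (n + 1)]. *)
  apply: (@le_lt_trans _ _
      (ereal_sup (range (fun n => \int[m]_x lip_a (g n) x)) + 1)%E).
    apply: ge_ereal_sup => _ [n _ <-]; apply: le_trans (hg n) _.
    apply: leeD; first by apply: ereal_sup_ubound; exists n.
    by rewrite lee_fin invf_le1// ler1n.
  by rewrite lte_add_pinfty// ltry.
move=> f [/mEFin mf _]; apply/eqP; rewrite eq_le; apply/andP; split.
  apply: le_ereal_inf_tmp => _ [g gf <-].
  have [h hf hg] := L1_approx_LIP_b radonm completeX mf gf.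
  apply: le_trans (limn_einf_le_perturb hg).
  by apply: ereal_inf_lbound; exists h.
(* The reverse inequality is an infimum over fewer competitors. *)
by apply: ereal_inf_le_tmp => _ [g gf <-]; exists g => //; exact: L1_sub.
Qed.
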